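(* Let $p$ be a prime number and let $K$ be any field with $\operatorname{char}K\neq p$ such that $\zeta_p\in K$, where $\zeta_p$ denotes a primitive $p$-th root of unity. Then for every positive integer $r$, $\operatorname{ed}_K((\mathbb{Z}/p\mathbb{Z})^r)=r$.
   Context: All fields are assumed to contain the ground field $K$. Let $L/L_0$ be a finite separable extension of fields containing $K$. For an intermediate field $K\subset E_0\subset L_0$, one says that $L/L_0$ is defined over $E_0$ if there is a field $E$ with $E_0\subset E\subset L$, $[E:E_0]=[L:L_0]$ and $L=EL_0$. The essential dimension $\operatorname{ed}_K(L/L_0)$ is the minimum of $\operatorname{trdeg}_K E_0$ (transcendence degree over $K$), where $E_0$ runs over all such fields over which $L/L_0$ is defined. For a finite group $G$, define $\operatorname{ed}_K(G)=\operatorname{ed}_K(K(V)/K(V)^G)$, where $G\to GL(V)$ is a faithful finite-dimensional representation over $K$, $K(V)=K(x_1,\ldots,x_n)$ is the rational function field in a basis $x_1,\ldots,x_n$ of the dual space of $V$ with the induced $G$-action, and $K(V)^G$ is the fixed field; this does not depend on the choice of the faithful representation. *)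

(* Defs.v *)
From mathcomp Require Import all_boot all_order all_algebra all_fingroup.
From mathcomp Require Import mxrepresentation generic_quotient fraction.
From mathcomp Require Import mpoly.

Set Implicit Arguments.
Unset Strict Implicit.
Unset Printing Implicit Defensive.

Import GRing.Theory.
Local Open Scope quotient_scope.
Local Open Scope ring_scope.

Section Subfields.

Variable L : fieldType.

(* Subfields are Prop-valued, as an arbitrary subfield need not be decidable. *)
Definition is_subfield (F : L -> Prop) : Prop :=
  [/\ F 1,
      forall x y, F x -> F y -> F (x - y),
      forall x y, F x -> F y -> F (x * y)
    & forall x, F x -> F x^-1].

Definition sub_set (A B : L -> Prop) : Prop := forall x, A x -> B x.

Definition gen_field (A : L -> Prop) (x : L) : Prop :=
  forall F : L -> Prop, is_subfield F -> sub_set A F -> F x.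

Definition compositum (E F : L -> Prop) : L -> Prop :=
  gen_field (fun x => E x \/ F x).

Definition full_field (x : L) : Prop := True.

(* [E : F] = d *)
Definition has_degree (F E : L -> Prop) (d : nat) : Prop :=
  exists e : 'I_d -> L,
    [/\ forall i, E (e i),
        forall x, E x ->
          exists2 c : 'I_d -> L, (forall i, F (c i)) & x = \sum_i c i * e i
      & forall c : 'I_d -> L, (forall i, F (c i)) ->
          \sum_i c i * e i = 0 -> forall i, c i = 0].

Definition is_algebraic (F : L -> Prop) (x : L) : Prop :=
  exists q : {poly L}, [/\ q != 0, forall i, F q`_i & root q x].

Variables (K : fieldType) (iota : {rmorphism K -> L}).

Definition ground (x : L) : Prop := exists a : K, x = iota a.

Definition alg_independent (d : nat) (t : 'I_d -> L) : Prop :=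
  forall q : {mpoly K[d]}, mmap iota t q = 0 -> q = 0.

(* trdeg_K E = d *)
Definition has_trdeg (E : L -> Prop) (d : nat) : Prop :=
  exists t : 'I_d -> L,
    [/\ forall i, E (t i),
        alg_independent t
      & forall x, E x ->
          is_algebraic (gen_field (fun y => ground y \/ exists i, y = t i)) x].

Definition defined_over (L0 E0 : L -> Prop) : Prop :=
  exists E : L -> Prop,
    [/\ is_subfield E,
        sub_set E0 E,
        exists2 d, has_degree L0 full_field d & has_degree E0 E d
      & sub_set full_field (compositum E L0)].

Definition intermediate_def_field (L0 E0 : L -> Prop) : Prop :=
  [/\ is_subfield E0, sub_set ground E0, sub_set E0 L0 & defined_over L0 E0].

(* ed_K(L/L0) = d.  Fields E0 of infinite transcendence degree satisfy no
   has_trdeg E0 d', and rightly play no role in the minimum. *)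
Definition has_ed (L0 : L -> Prop) (d : nat) : Prop :=
  (exists2 E0, intermediate_def_field L0 E0 & has_trdeg E0 d) /\
  (forall E0 d', intermediate_def_field L0 E0 -> has_trdeg E0 d' -> (d <= d')%N).

End Subfields.

Local Notation "x %:F" := (FracField.tofrac x).

Section RationalFunctions.

Variables (K : fieldType) (n : nat).

Definition ratfun : fieldType := {fraction {mpoly K[n]}}.

Definition ratfunC : {rmorphism K -> ratfun} :=
  (@FracField.tofrac {mpoly K[n]}) \o (@mpolyC n K).

Variables (gT : finGroupType) (G : {group gT}) (rG : mx_representation K G n).

(* V is the space of row vectors v, on which g acts by v |-> v *m rG g, and
   'X_i is its i-th coordinate function.  As rG (g * h) = rG g *m rG h,
   (g . f)(v) = f (v *m rG g) is a left action on functions. *)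
Definition polyact (g : gT) (f : {mpoly K[n]}) : {mpoly K[n]} :=
  f \mPo [tuple \sum_(j < n) rG g j i *: 'X_j | i < n].

Definition ratact (g : gT) (f : ratfun) : ratfun :=
  (polyact g \n_(repr f))%:F / (polyact g \d_(repr f))%:F.

Definition fixed_field (f : ratfun) : Prop :=
  forall g, g \in G -> ratact g f = f.

Lemma polyactM (g h : gT) (f : {mpoly K[n]}) : g \in G -> h \in G ->
  polyact g (polyact h f) = polyact (g * h)%g f.
Proof.
move=> Gg Gh; rewrite /polyact !(comp_mpolyEX f) raddf_sum /=; apply: eq_bigr => m _.
rewrite comp_mpolyZ !comp_mpolyX rmorph_prod /=; congr (_ *: _).
apply: eq_bigr => i _; rewrite rmorphXn /=; congr (_ ^+ _).
rewrite !tnth_mktuple raddf_sum /= (repr_mxM rG) //.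
under eq_bigr => j _.
  rewrite comp_mpolyZ comp_mpolyXU -tnth_nth tnth_mktuple scaler_sumr; over.
rewrite exchange_big; apply: eq_bigr => k _ /=.
rewrite mxE scaler_suml; apply: eq_bigr => j _.
by rewrite scalerA mulrC.
Qed.

Lemma polyact1 (f : {mpoly K[n]}) : polyact 1%g f = f.
Proof.
rewrite /polyact -[RHS]comp_mpoly_id; congr (_ \mPo _).
apply: eq_from_tnth => i; rewrite !tnth_mktuple (repr_mx1 rG) (bigD1 i) //=.
rewrite mxE eqxx scale1r big1 ?addr0 // => j /negPf nji.
by rewrite mxE nji scale0r.
Qed.

Lemma polyact_eq0 (g : gT) (f : {mpoly K[n]}) : g \in G ->
  (polyact g f == 0) = (f == 0).
Proof.
move=> Gg; apply/eqP/eqP => [f0|->]; last by rewrite /polyact comp_mpoly0.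
rewrite -[f]polyact1 -(mulVg g) -polyactM ?groupV // f0.
by rewrite /polyact comp_mpoly0.
Qed.

Lemma repr_frac (x : ratfun) : x * (\d_(repr x))%:F = (\n_(repr x))%:F.
Proof.
have /(_ (repr x)) : forall y : {ratio {mpoly K[n]}},
  \pi_(FracField.type _) y * (\d_y)%:F = (\n_y)%:F :> ratfun.
  move=> y; have y0 : \d_y != 0 := denom_ratioP y.
  rewrite !piE; apply/eqmodP; rewrite /= FracField.equivfE /FracField.mulf.
  by rewrite !numden_Ratio ?mulf_neq0 ?oner_eq0 // !mulr1 mulrC.
by rewrite reprK.
Qed.

(* ratact does not depend on the representative chosen by repr. *)
Lemma ratact_div (g : gT) (a b : {mpoly K[n]}) : g \in G -> b != 0 ->
  ratact g (a%:F / b%:F) = (polyact g a)%:F / (polyact g b)%:F.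
Proof.
move=> Gg b0; rewrite /ratact; set x := a%:F / b%:F.
have xd0 : \d_(repr x) != 0 := denom_ratioP (repr x).
have e : a * \d_(repr x) = b * \n_(repr x).
  apply/eqP; rewrite -tofrac_eq !rmorphM /= -repr_frac mulrA; apply/eqP.
  by congr (_ * _); rewrite /x mulrC divfK // tofrac_eq0.
apply/eqP; rewrite eqr_div ?tofrac_eq0 ?polyact_eq0 // -!rmorphM tofrac_eq.
by rewrite e mulrC.
Qed.

End RationalFunctions.

(* ed_K(G) = d.  Every faithful representation is required to give the value d,
   so independence of the choice is part of the assertion; it is never vacuous,
   since the regular representation is faithful. *)
Definition has_edG (K : fieldType) (gT : finGroupType) (G : {group gT})
    (d : nat) : Prop :=
  forall (n : nat) (rG : mx_representation K G n),
    mx_faithful rG -> has_ed (ratfunC K n) (fixed_field rG) d.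

(* Main.v *)
Require Import Defs.
From HB Require Import structures.
From mathcomp Require Import all_boot all_order all_algebra all_fingroup.
From mathcomp Require Import ring.
From mathcomp Require Import boolp mpoly mxrepresentation generic_quotient.

(** Let G = (Z/p)^r act faithfully on K^n.  The matrices of G commute and are
killed by X^p - 1, which splits with simple roots, so they are simultaneously
diagonal and K(V) is generated by eigenvectors whose weights (characters
G -> K^* ) separate the elements of G.  A minimal separating set of weights has
exactly r members and admits a dual family of group elements
([dual_family]); let y_1, ..., y_r be eigenvectors with such weights.

Upper bound.  Splitting L = K(V) into eigenspaces, the monomials y^a with
exponents in [0, p[ form a basis of L over L^G, and also of E = K(y_1, ..., y_r)
over E_0 = E :&: L^G.  Hence L / L^G is defined over E_0, whose transcendence
basis is given by the powers y_i^p ([y_fixed_intermediate], [y_fixed_trdeg]).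

Lower bound.  Suppose that L = E L^G with E / E_0 of degree [L : L^G], and
let A be the algebraic closure of E_0 in L: it contains E, it is G-stable as
E_0 is fixed by G, and no g != 1 acts trivially on it, as otherwise g would
fix E L^G = L.  Projecting elements of A on eigenspaces yields eigenvectors of A
whose weights separate G, and [dual_family] extracts r of them, z_1, ..., z_r,
with a dual family h_1, ..., h_r in G.

It remains to see that these are algebraically independent over K, since A has
the transcendence degree of E_0; the comparison is the exchange theorem
([steinitz]).  This is where rational functions enter.  In eigencoordinates,
send a / b to the difference in Z^n of the leading exponents of a and b.
It is a valuation trivial on K, and G acts trivially on leading
coefficients of elements of value 0 ([lead_exponent_rigid]).  If integers a_i
satisfy sum a_i v(z_i) = 0, the product of the z_i^(a_i) has value 0, so
its weight is trivial; evaluated at h_j this says that p divides a_j.  Dividing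
by p and starting again, every a_i vanishes.  So the values of the z_i are
independent over Z, distinct monomials in the z_i have distinct values, and no
nontrivial combination of them can vanish. *)

Set Implicit Arguments.
Unset Strict Implicit.
Unset Printing Implicit Defensive.

Import Order.TTheory GRing.Theory.
Local Open Scope ring_scope.

Local Notation "x %:F" := (FracField.tofrac x).

(** * Subfields given by predicates *)

Section SubfieldEmbedding.

Variables (L : fieldType) (F : L -> Prop) (sfF : is_subfield F).

(** The proof that F is a subfield is a dummy argument, so that the canonical
structures attached to this predicate can be found from it. *)
Definition subfield_pred (_ : is_subfield F) : {pred L} := fun x => `[< F x >].

Lemma subfield_pred_closed : divring_closed (subfield_pred sfF).
Proof.
case: sfF => F1 FB FM FV.
split=> [|x y /asboolP Fx /asboolP Fy|x y /asboolP Fx /asboolP Fy]; apply/asboolP.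
- exact: F1.
- exact: FB.
- by apply: FM => //; apply: FV.
Qed.

HB.instance Definition _ :=
  GRing.isDivringClosed.Build L (subfield_pred sfF) subfield_pred_closed.

Definition subfield_type := {x : L | x \in subfield_pred sfF}.

HB.instance Definition _ := SubChoice.on subfield_type.
HB.instance Definition _ :=
  [SubChoice_isSubIntegralDomain of subfield_type by <:].
HB.instance Definition _ :=
  [SubIntegralDomain_isSubField of subfield_type by <:].

(** Makes the theory of polynomials and of integral elements over an actual
field type available for a subfield that is a mere predicate. *)
Lemma subfield_embedding :
  exists (F' : fieldType) (i : {rmorphism F' -> L}),
    forall x, F x <-> exists a, x = i a.
Proof.
exists subfield_type, (\val : {rmorphism subfield_type -> L}) => x.
split=> [Fx|[a ->]]; last exact/asboolP/(valP a).
have Px : x \in subfield_pred sfF by apply/asboolP.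
by exists (Sub x Px : subfield_type).
Qed.

End SubfieldEmbedding.

Section AlgebraicClosure.

Variable L : fieldType.
Implicit Types (F A : L -> Prop) (x y : L).

Lemma subfield_sum F (I : Type) (s : seq I) (P : pred I) (f : I -> L) :
  is_subfield F -> (forall i, P i -> F (f i)) -> F (\sum_(i <- s | P i) f i).
Proof.
case=> F1 FB _ _ Ff; have F0 : F 0 by rewrite -(subrr 1); apply: FB.
apply: big_ind Ff => // x y Fx Fy; rewrite -[y]opprK -[- y]sub0r.
by apply: (FB) => //; apply: FB.
Qed.

Lemma subfield_prod F (I : Type) (s : seq I) (P : pred I) (f : I -> L) :
  is_subfield F -> (forall i, P i -> F (f i)) -> F (\prod_(i <- s | P i) f i).
Proof. by case=> F1 _ FM _; apply: big_ind. Qed.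

Lemma subfield_exp F x n : is_subfield F -> F x -> F (x ^+ n).
Proof. by case=> F1 _ FM _ Fx; elim: n => // n IHn; rewrite exprS; apply: FM. Qed.

Lemma subfield_horner F (q : {poly L}) x :
  is_subfield F -> (forall k, F q`_k) -> F x -> F q.[x].
Proof.
move=> sfF Fq Fx; rewrite horner_coef; apply: subfield_sum => // k _.
by case: (sfF) => _ _ FM _; apply: FM; last exact: subfield_exp.
Qed.

Lemma gen_field_subfield A : is_subfield (gen_field A).
Proof.
split=> [F [] //|x y Ax Ay F sfF sAF|x y Ax Ay F sfF sAF|x Ax F sfF sAF];
  case: (sfF) => _ FB FM FV.
- by apply: FB; [apply: Ax | apply: Ay].
- by apply: FM; [apply: Ax | apply: Ay].
- by apply: FV; apply: Ax.
Qed.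

Lemma sub_gen_field A x : A x -> gen_field A x.
Proof. by move=> Ax F _; apply. Qed.

Lemma gen_field_min A F : is_subfield F -> sub_set A F -> sub_set (gen_field A) F.
Proof. by move=> sfF sAF x; apply. Qed.

(** An explicit upper bound for generated fields: whatever is generated by
values of f is a quotient of two values of f.  It serves for polynomials in
one variable over a subfield and for polynomials in several variables. *)
Lemma fractions_subfield (R : comNzRingType) (f : {rmorphism R -> L}) :
  is_subfield (fun x => exists a b, f b != 0 /\ x = f a / f b).
Proof.
split=> [|_ _ [a [b [b0 ->]]] [c [d [d0 ->]]]|_ _ [a [b [b0 ->]]] [c [d [d0 ->]]]|].
- by exists 1, 1; rewrite rmorph1 oner_eq0 divr1.
- exists (a * d - c * b), (b * d); rewrite rmorphB !rmorphM mulf_neq0 //.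
  by split=> //; field; apply/andP.
- exists (a * c), (b * d); rewrite !rmorphM mulf_neq0 //.
  by split=> //; field; apply/andP.
- move=> _ [a [b [b0 ->]]]; have [a0|a0] := eqVneq (f a) 0.
    by exists 0, 1; rewrite rmorph1 oner_eq0 a0 rmorph0 !mul0r invr0.
  by exists b, a; rewrite invf_div.
Qed.

Lemma is_algebraicE (F : L -> Prop) (F' : fieldType) (i : {rmorphism F' -> L}) x :
    (forall z, F z <-> exists a, z = i a) ->
  is_algebraic F x <-> algebraicOver i x.
Proof.
move=> FE; split=> [[q [q0 Fq qx0]]|[q q0 qx0]]; last first.
  exists (map_poly i q); rewrite map_poly_eq0; split=> // k.
  by apply/FE; exists q`_k; rewrite coef_map.
have /fin_all_exists[a Da] (k : 'I_(size q)) : exists a, q`_k = i a by apply/FE.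
have qE : q = map_poly i (\poly_(k < size q) oapp a 0 (insub k)).
  apply/polyP=> k; rewrite coef_map coef_poly.
  case: insubP => [k' ltk Dk|/negPf nltk] /=; first by rewrite ltk -Dk Da.
  by rewrite nltk rmorph0 nth_default // leqNgt nltk.
by exists (\poly_(k < size q) oapp a 0 (insub k)); rewrite -?qE // -(map_poly_eq0 i) -qE.
Qed.

Lemma is_algebraic_mono (F F' : L -> Prop) x :
  sub_set F F' -> is_algebraic F x -> is_algebraic F' x.
Proof. by move=> sFF' [q [q0 Fq qx0]]; exists q; split=> // k; apply: sFF'. Qed.

Lemma is_algebraic_self F x : is_subfield F -> F x -> is_algebraic F x.
Proof.
move=> sfF; have [F' [i FE]] := subfield_embedding sfF.
by move=> /FE[a ->]; apply/(is_algebraicE _ FE)/algebraic_id.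
Qed.

Lemma is_algebraic_subfield F : is_subfield F -> is_subfield (is_algebraic F).
Proof.
move=> sfF; have [F' [i FE]] := subfield_embedding sfF.
have AE x := is_algebraicE x FE.
split=> [|x y /AE Ax /AE Ay|x y /AE Ax /AE Ay|x /AE Ax]; apply/AE.
- exact: algebraic1.
- exact: algebraic_sub.
- exact: algebraic_mul.
- exact: algebraic_inv.
Qed.

Lemma is_algebraic_trans F F' x : is_subfield F -> is_subfield F' ->
  sub_set F' (is_algebraic F) -> is_algebraic F' x -> is_algebraic F x.
Proof.
move=> sfF sfF' algF' [q [q0 F'q qx0]].
have [K [i FE]] := subfield_embedding sfF.
apply/(is_algebraicE _ FE)/integral_algebraic.
apply: integral_root q0 qx0 _ => _ /(nthP 0)[k _ <-].
by apply/integral_algebraic/(is_algebraicE _ FE)/algF'.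
Qed.

(** Clearing denominators, an equation for x over F(y) is a polynomial relation
Q(x, y) = 0 with coefficients in F.  Read as a polynomial in y, its coefficients
are polynomials in x over F, and those that are nonzero as polynomials do not
vanish at x, as x is transcendental: so it is an equation for y over F(x). *)
Lemma is_algebraic_exchange F x y : is_subfield F ->
    is_algebraic (gen_field (fun z => F z \/ z = y)) x -> ~ is_algebraic F x ->
  is_algebraic (gen_field (fun z => F z \/ z = x)) y.
Proof.
move=> sfF [q [q0 Fyq /rootP qx0]] ntx.
have [K [i FE]] := subfield_embedding sfF.
pose f : {rmorphism {poly K} -> L} := horner_eval y \o map_poly i.
have fracF : sub_set (gen_field (fun z => F z \/ z = y))
                     (fun z => exists a b, f b != 0 /\ z = f a / f b).
  apply: gen_field_min (fractions_subfield f) _ => z [/FE[a ->]|->].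
    exists a%:P, 1; rewrite rmorph1 oner_eq0 divr1 /f /= /horner_eval.
    by rewrite map_polyC hornerC.
  exists 'X, 1; rewrite rmorph1 oner_eq0 divr1 /f /= /horner_eval.
  by rewrite map_polyX hornerX.
have /fin_all_exists[a] (k : 'I_(size q)) := fracF _ (Fyq k).
case/fin_all_exists=> b /all_and2[b0 Dq].
(* f (A k) / c is the k-th coefficient of q, over a common denominator. *)
pose A k := a k * \prod_(l | l != k) b l; pose c := f (\prod_l b l).
have c0 : c != 0 by rewrite /c rmorph_prod; apply/prodf_neq0.
have fA k : f (A k) = c * q`_k.
  have -> : c = f (b k) * f (\prod_(l | l != k) b l) by rewrite /c (bigD1 k) // rmorphM.
  by rewrite Dq /A rmorphM; field.
pose P k := \poly_(j < size q) oapp (fun j' => (A j')`_k) 0 (insub j).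
(* The relation Q(x, .), seen as a polynomial in its second variable. *)
pose R := \sum_(k < size q) (x ^+ k) *: map_poly i (A k).
have RE j : R`_j = (map_poly i (P j)).[x].
  have szP : (size (map_poly i (P j)) <= size q)%N by rewrite size_map_poly size_poly.
  rewrite (horner_coef_wide _ szP).
  rewrite coef_sum; apply: eq_bigr => k _.
  by rewrite coefZ !coef_map coef_poly ltn_ord valK mulrC.
exists R; split.
- have [k qk0] : exists k : 'I_(size q), q`_k != 0.
    have szq : (0 < size q)%N by rewrite size_poly_gt0.
    have lt : ((size q).-1 < size q)%N by rewrite prednK.
    by exists (Ordinal lt); rewrite /= -/(lead_coef q) lead_coef_eq0.
  have Ak0 : A k != 0.
    apply: contraNneq qk0 => Ak0; move: (fA k); rewrite Ak0 rmorph0 => /esym/eqP.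
    by rewrite mulf_eq0 (negPf c0).
  have /eqP : lead_coef (A k) != 0 by rewrite lead_coef_eq0.
  rewrite lead_coefE; set j := (size _).-1 => Akj.
  apply/eqP=> R0; apply: ntx; apply/(is_algebraicE _ FE); exists (P j).
    apply/eqP=> /polyP/(_ k); rewrite coef_poly ltn_ord valK /= coef0; exact: Akj.
  by apply/rootP; rewrite -RE R0 coef0.
- move=> j; rewrite RE; apply: subfield_horner (gen_field_subfield _) _ _.
    by move=> k; apply: sub_gen_field; left; apply/FE; rewrite coef_map; exists (P j)`_k.
  by apply: sub_gen_field; right.
- apply/rootP; rewrite /R horner_sum -[RHS](mulr0 c) -[in RHS]qx0 horner_coef mulr_sumr.
  apply: eq_bigr => k _; rewrite hornerZ mulrA -fA mulrC.
  by rewrite /f /= /horner_eval.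
Qed.

End AlgebraicClosure.

(** * Algebraic dependence and the exchange theorem *)

(** x is an eigenvalue of the matrix over F of multiplication by x on E, hence
a root of its characteristic polynomial. *)
Lemma finite_degree_algebraic (L : fieldType) (F E : L -> Prop) d x :
  is_subfield F -> is_subfield E -> has_degree F E d -> E x -> is_algebraic F x.
Proof.
move=> sfF sfE [e [Ee spanE freeE]] Ex.
have [K [i FE]] := subfield_embedding sfF.
case: (sfE) => E1 _ EM _.
have /fin_all_exists[c] (k : 'I_d) : exists c : 'I_d -> K, x * e k = \sum_l i (c l) * e l.
  have [c Fc ->] := spanE _ (EM _ _ Ex (Ee k)).
  have /fin_all_exists[c' Dc] l : exists a, c l = i a by apply/FE.
  by exists c'; apply: eq_bigr => l _; rewrite Dc.
move=> Dx; pose M := \matrix_(l, k) c k l; pose v := \row_l e l.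
have ev : v *m map_mx i M = x *: v.
  apply/rowP=> k; rewrite !mxE Dx; apply: eq_bigr => l _; rewrite !mxE; exact: mulrC.
have v0 : v != 0.
  apply/eqP=> v0; have e0 l : e l = 0 by have /rowP/(_ l) := v0; rewrite !mxE.
  have [c1 _] := spanE _ E1; rewrite big1 => [/eqP|l _]; last by rewrite e0 mulr0.
  by rewrite oner_eq0.
apply/(is_algebraicE _ FE); exists (char_poly M); first exact/monic_neq0/char_poly_monic.
rewrite map_char_poly -eigenvalue_root_char; apply/eigenvalueP.
by exists v.
Qed.

Section Steinitz.

Variables (K L : fieldType) (iota : {rmorphism K -> L}).
Implicit Types (A B : L -> Prop) (x y : L).

Definition alg_over A : L -> Prop :=
  is_algebraic (gen_field (fun y => ground iota y \/ A y)).

Lemma alg_over_subfield A : is_subfield (alg_over A).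
Proof. exact/is_algebraic_subfield/gen_field_subfield. Qed.

Lemma alg_over_ground A c : alg_over A (iota c).
Proof.
apply: is_algebraic_self (gen_field_subfield _) _.
by apply: sub_gen_field; left; exists c.
Qed.

Lemma sub_alg_over A : sub_set A (alg_over A).
Proof.
move=> x Ax; apply: is_algebraic_self (gen_field_subfield _) _.
by apply: sub_gen_field; right.
Qed.

Lemma alg_over_trans A B :
  sub_set A (alg_over B) -> sub_set (alg_over A) (alg_over B).
Proof.
move=> AB x; apply: is_algebraic_trans; [exact: gen_field_subfield..|].
apply: gen_field_min (alg_over_subfield B) _ => y [[c ->]|/AB //].
exact: alg_over_ground.
Qed.

Lemma alg_over_mono A B : sub_set A B -> sub_set (alg_over A) (alg_over B).
Proof. by move=> AB; apply: alg_over_trans => x /AB; apply: sub_alg_over. Qed.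

Lemma alg_over_exchange A x y :
    alg_over (fun z => A z \/ z = y) x -> ~ alg_over A x ->
  alg_over (fun z => A z \/ z = x) y.
Proof.
move=> Ayx nAx; set F := gen_field (fun y => ground iota y \/ A y).
have sfF : is_subfield F := gen_field_subfield _.
have : is_algebraic (gen_field (fun z => F z \/ z = y)) x.
  apply: is_algebraic_mono Ayx.
  apply: gen_field_min (gen_field_subfield _) _ => z [gz|[Az|->]];
    apply: sub_gen_field; last (by right); left; apply: sub_gen_field; by [left | right].
move/(is_algebraic_exchange sfF)/(_ nAx).
apply: is_algebraic_mono.
apply: gen_field_min (gen_field_subfield _) _ => z [Fz|->].
  move: z Fz; apply: gen_field_min (gen_field_subfield _) _ => u [gu|Au].
    by apply: sub_gen_field; left.
  by apply: sub_gen_field; right; left.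
by apply: sub_gen_field; right; right.
Qed.

(** Replace t's by z's one at a time.  After k steps, z_0, ..., z_(k-1)
and the t_j with j in a set T of size d - k still generate all the t's.  The next
z depends on these, but not on the other z's alone, so a minimal subset of T on
which it depends is nonempty, and any member of it can be exchanged for it. *)
Lemma steinitz r d (z : 'I_r -> L) (t : 'I_d -> L) :
    (forall i, ~ alg_over (fun y => exists2 j, j != i & y = z j) (z i)) ->
    (forall i, alg_over (fun y => exists j, y = t j) (z i)) ->
  (r <= d)%N.
Proof.
move=> indz algz.
pose S k (T : {set 'I_d}) y :=
  (exists2 j : 'I_r, (j < k)%N & y = z j) \/ (exists2 j, j \in T & y = t j).
have: forall k, (k <= r)%N -> exists2 T : {set 'I_d},
    (#|T| + k = d)%N & forall i, alg_over (S k T) (t i).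
  elim=> [_|k IHk ltkr].
    exists setT; first by rewrite cardsT card_ord addn0.
    by move=> i; apply: sub_alg_over; right; exists i; rewrite ?inE.
  have [T cardT algT] := IHk (ltnW ltkr); pose i := Ordinal ltkr.
  pose P (U : {set 'I_d}) := `[< alg_over (S k U) (z i) >].
  have PT : P T by apply/asboolP; apply: alg_over_trans (algz i) => _ [j ->].
  have [U /minsetP[/asboolP PU minU] sUT] := minset_exists PT.
  have [tau Utau] : exists tau, tau \in U.
    apply/set0Pn/eqP=> U0; apply: (indz i); apply: alg_over_mono PU => y.
    rewrite U0 => -[[j ltjk ->]|[j]]; last by rewrite inE.
    by exists j => //; rewrite neq_ltn ltjk.
  have Ttau : tau \in T := subsetP sUT _ Utau.
  (* tau can be exchanged for z_k, as U without tau no longer suffices. *)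
  have exch : alg_over (fun y => S k (U :\ tau) y \/ y = z i) (t tau).
    apply: alg_over_exchange.
      apply: alg_over_mono PU => y [zy|[j Uj ->]]; first by left; left.
      have [->|ntau] := eqVneq j tau; first by right.
      by left; right; exists j; rewrite // !inE ntau.
    move=> PUtau; have /setP/(_ tau) := minU (U :\ tau) (asboolT PUtau) (subD1set _ _).
    by rewrite !inE eqxx Utau.
  exists (T :\ tau).
    by move: cardT; rewrite (cardsD1 tau) Ttau add1n addSn addnS.
  move=> j; apply: alg_over_trans (algT j) => y [[l ltlk ->]|[l Tl ->]].
    by apply: sub_alg_over; left; exists l; rewrite // ltnS ltnW.
  have [->|ntau] := eqVneq l tau; last first.
    by apply: sub_alg_over; right; exists l; rewrite // !inE ntau.
  apply: alg_over_mono exch => _ [[[m ltmk ->]|[m /setD1P[nm Um] ->]]|->].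
  - by left; exists m; rewrite // ltnS ltnW.
  - by right; exists m; rewrite // !inE nm (subsetP sUT).
  - by left; exists i.
by move=> /(_ r (leqnn r))[T cardT _]; rewrite -[X in (_ <= X)%N]cardT leq_addl.
Qed.

End Steinitz.

(** * Value maps and algebraic independence *)

Section ValueMap.

Variables (K L : fieldType) (iota : {rmorphism K -> L}).
Variables (Gamma : zmodType) (v : L -> Gamma).

(** A valuation without its ordering: the ultrametric inequality is kept
only in the case of two distinct values, where the value of the sum is one
of the two. *)
Definition value_map : Prop :=
  [/\ forall x y, x != 0 -> y != 0 -> v (x * y) = v x + v y,
      forall x y, x != 0 -> y != 0 -> v x != v y ->
        x + y != 0 /\ (v (x + y) = v x \/ v (x + y) = v y)
    & forall c, c != 0 -> v (iota c) = 0].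

Definition int_independent r (w : 'I_r -> Gamma) : Prop :=
  forall a : 'I_r -> int, \sum_i w i *~ a i = 0 -> forall i, a i = 0.

Hypothesis vmap : value_map.

Let vM x y : x != 0 -> y != 0 -> v (x * y) = v x + v y.
Proof. by case: vmap => vM _ _; apply: vM. Qed.

Lemma value1 : v 1 = 0.
Proof. by case: vmap => _ _ vC; rewrite -(rmorph1 iota) vC ?oner_eq0. Qed.

Lemma valueX x n : x != 0 -> v (x ^+ n) = v x *+ n.
Proof.
move=> x0; elim: n => [|n IHn]; first by rewrite value1.
by rewrite exprS mulrS vM ?expf_neq0 // IHn.
Qed.

Lemma valueV x : x != 0 -> v x^-1 = - v x.
Proof.
move=> x0; apply/eqP; rewrite -addr_eq0 -vM ?invr_eq0 //.
by rewrite mulVf // value1.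
Qed.

Lemma valueXz x (n : int) : x != 0 -> v (x ^ n) = v x *~ n.
Proof.
by move=> x0; case: n => n; rewrite /exprz /intmul ?valueV ?valueX ?expf_neq0.
Qed.

Lemma value_prod (I : Type) (s : seq I) (f : I -> L) :
  (forall i, f i != 0) -> v (\prod_(i <- s) f i) = \sum_(i <- s) v (f i).
Proof.
move=> f0; elim: s => [|i s IHs]; first by rewrite !big_nil value1.
have s0 : \prod_(j <- s) f j != 0.
  apply: (big_ind (fun x : L => x != 0)) => // [|x y]; first exact: oner_neq0.
  exact: mulf_neq0.
by rewrite !big_cons vM // IHs.
Qed.

(** Terms with pairwise distinct values cannot cancel: adding them one at a time,
the value of the partial sum remains one of those already met, hence
differs from the value of the next term. *)
Lemma value_sum (I : eqType) (s : seq I) (f : I -> L) :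
    s != [::] -> uniq s -> (forall i, i \in s -> f i != 0) ->
    {in s &, injective (fun i => v (f i))} ->
  \sum_(i <- s) f i != 0 /\
  exists2 i, i \in s & v (\sum_(i <- s) f i) = v (f i).
Proof.
elim: s => // i [|j s] IHs _ /andP[si us] f0 vinj.
  by rewrite big_seq1 f0 ?mem_head //; split=> //; exists i; rewrite ?mem_head.
have [] // := IHs isT us.
- by move=> k sk; apply: f0; rewrite inE sk orbT.
- by move=> k l sk sl; apply: vinj; rewrite inE ?sk ?sl orbT.
move=> s0 [k sk vs]; rewrite big_cons.
have i0 : f i != 0 by rewrite f0 ?mem_head.
case: vmap => _ vD _.
have [] // := vD _ _ i0 s0.
  rewrite vs; apply: contraNneq si => /vinj ->//; rewrite ?mem_head //.
  by rewrite inE sk orbT.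
move=> -> [->|->]; split=> //; first by exists i; rewrite ?mem_head.
by exists k; rewrite ?vs // inE sk orbT.
Qed.

(** By independence over Z, distinct monomials have distinct values. *)
Lemma value_mmap r (z : 'I_r -> L) (q : {mpoly K[r]}) :
    (forall i, z i != 0) -> int_independent (fun i => v (z i)) -> q != 0 ->
  mmap iota z q != 0 /\
  exists m : 'I_r -> nat, v (mmap iota z q) = \sum_i v (z i) *+ m i.
Proof.
move=> z0 indz q0; pose f m := iota q@_m * mmap1 z m.
have z0m m : mmap1 z m != 0 by apply/prodf_neq0 => i _; rewrite expf_neq0.
have vf m : m \in msupp q -> v (f m) = \sum_i v (z i) *+ m i.
  rewrite mcoeff_msupp => qm0; rewrite vM ?fmorph_eq0 //.
  case: vmap => _ _ vC; rewrite vC // add0r value_prod; last first.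
    by move=> i; rewrite expf_neq0.
  by apply: eq_bigr => i _; rewrite valueX.
have [] := @value_sum _ (msupp q) f.
- by rewrite msupp_eq0.
- exact: msupp_uniq.
- by move=> m; rewrite mcoeff_msupp => qm0; rewrite mulf_neq0 ?fmorph_eq0.
- move=> m n qm qn /eqP; rewrite /= !vf // -subr_eq0 => /eqP.
  rewrite -sumrB => vmn; apply/mnmP => i; apply/eqP.
  rewrite -eqz_nat -subr_eq0; apply/eqP; move: i; apply: indz.
  by rewrite -[RHS]vmn; apply: eq_bigr => i _; rewrite mulrzBr.
by move=> ? [m qm vq]; split=> //; exists m; rewrite -vf.
Qed.

Lemma int_independent_alg r (z : 'I_r -> L) :
    (forall i, z i != 0) -> int_independent (fun i => v (z i)) ->
  alg_independent iota z.
Proof.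
move=> z0 indz q qz0; apply: contra_eq qz0 => q0.
by have [] := value_mmap z0 indz q0.
Qed.

(** By [value_mmap], the values of the field generated by the other z's are
integral combinations of their values.  No nonzero multiple of the value of z_i
is such a combination, so in a polynomial expression in z_i over this field the
terms have distinct values and do not cancel. *)
Lemma int_independent_transcendental r (z : 'I_r -> L) i :
    (forall i, z i != 0) -> int_independent (fun i => v (z i)) ->
  ~ alg_over iota (fun y => exists2 j, j != i & y = z j) (z i).
Proof.
case: r => [|r] in z i *; first by case: i.
move=> z0 indz [q [q0 Fq /rootP qz0]].
pose z' (j : 'I_r) := z (lift i j).
have indz' : int_independent (fun j => v (z' j)).
  move=> a az; pose b j := oapp a 0 (unlift i j).
  have/(_ b) := indz.
  rewrite (bigD1_ord i) //= /b unlift_none mulr0z add0r.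
  under eq_bigr do rewrite liftK.
  by move/(_ az)=> b0 j; have := b0 (lift i j); rewrite liftK.
have valF k : q`_k != 0 -> exists a : 'I_r -> int, v q`_k = \sum_j v (z' j) *~ a j.
  have: exists a b, mmap iota z' b != 0 /\ q`_k = mmap iota z' a / mmap iota z' b.
    apply: (gen_field_min (fractions_subfield _) _ (Fq k)).
    move=> y [[c ->]|[j nji ->]].
      by exists c%:MP, 1; rewrite rmorph1 /= mmapC oner_eq0 divr1.
    rewrite eq_sym in nji; have [j' -> _] := unlift_some nji.
    by exists 'X_j', 1; rewrite rmorph1 /= mmapX mmap1U oner_eq0 divr1.
  have z'0 j : z' j != 0 by apply: z0.
  case=> a [b [b0 ->]]; rewrite mulf_eq0 negb_or => /andP[a0 _].
  have neq0 (c : {mpoly K[r]}) : mmap iota z' c != 0 -> c != 0.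
    by apply: contraNneq => ->; rewrite rmorph0.
  have [_ [m vm]] := value_mmap z'0 indz' (neq0 _ a0).
  have [_ [n vn]] := value_mmap z'0 indz' (neq0 _ b0).
  exists (fun j => (m j)%:Z - (n j)%:Z).
  rewrite vM ?invr_eq0 // valueV // vm vn -sumrB.
  by apply: eq_bigr => j _; rewrite mulrzBr.
pose s := [seq k <- index_iota 0 (size q) | q`_k != 0].
have vs k : q`_k != 0 -> v (q`_k * z i ^+ k) = v q`_k + v (z i) *+ k.
  by move=> qk0; rewrite vM ?expf_neq0 // valueX.
have [] := @value_sum _ s (fun k => q`_k * z i ^+ k).
- have: (size q).-1 \in s.
    rewrite mem_filter -/(lead_coef q) lead_coef_eq0 q0 mem_index_iota /=.
    by rewrite prednK // size_poly_gt0.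
  by case: s.
- by rewrite filter_uniq // iota_uniq.
- by move=> k; rewrite mem_filter => /andP[qk0 _]; rewrite mulf_neq0 ?expf_neq0.
- move=> k l; rewrite !mem_filter => /andP[qk0 _] /andP[ql0 _] /=.
  have [[a va] [b vb]] := (valF k qk0, valF l ql0); rewrite !vs // va vb => vkl.
  (* The relation to which an equality of two of these values amounts. *)
  pose c j : int := oapp (fun j' => a j' - b j') (k%:Z - l%:Z) (unlift i j).
  have cz : \sum_j v (z j) *~ c j = 0.
    rewrite (bigD1_ord i) //= /c unlift_none /= mulrzBr.
    under eq_bigr do rewrite liftK /= mulrzBr.
    rewrite sumrB addrACA [_ + \sum_j _]addrC vkl -opprD [X in X - _]addrC.
    exact: subrr.
  have := indz c cz i; rewrite /c unlift_none /= => /eqP.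
  by rewrite subr_eq0 eqz_nat => /eqP.
move=> /eqP[]; rewrite big_filter -[RHS]qz0 horner_coef.
rewrite -(big_mkord xpredT (fun k => q`_k * z i ^+ k)).
rewrite [LHS]big_mkcond; apply: eq_bigr => k _.
by case: eqP => //= ->; rewrite mul0r.
Qed.

End ValueMap.

(** * Characters of a group of exponent p *)

Definition is_char (gT : finGroupType) (K : fieldType) (chi : gT -> K) : Prop :=
  chi 1%g = 1 /\ {morph chi : g h / (g * h)%g >-> g * h}.

Section Characters.

Variables (p : nat) (K : fieldType) (zeta : K) (gT : finGroupType).
Hypotheses (prime_p : prime p) (zetaP : p.-primitive_root zeta).
Hypothesis (exp_p : forall g : gT, (g ^+ p)%g = 1%g).

Implicit Types (chi : gT -> K) (g h : gT).

Lemma is_charX chi g n : is_char chi -> chi (g ^+ n)%g = chi g ^+ n.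
Proof. by case=> c1 cM; elim: n => [|n IHn]; rewrite ?expg0 // expgS cM IHn exprS. Qed.

Lemma is_char_prod chi (I : Type) (s : seq I) (f : I -> gT) : is_char chi ->
  chi (\prod_(i <- s) f i)%g = \prod_(i <- s) chi (f i).
Proof. by case=> c1 cM; apply: big_morph. Qed.

Lemma is_char_root chi g : is_char chi -> chi g ^+ p = 1.
Proof. by move=> cchi; rewrite -is_charX // exp_p cchi.1. Qed.

Lemma is_char_neq0 chi g : is_char chi -> chi g != 0.
Proof.
move=> /(is_char_root g)/eqP; apply: contraTneq => ->.
by rewrite expr0n gtn_eqF ?prime_gt0 // eq_sym oner_eq0.
Qed.

Lemma is_charV chi g : is_char chi -> chi g^-1%g = (chi g)^-1.
Proof.
move=> cchi; apply: (mulIf (is_char_neq0 g cchi)); rewrite mulVf ?is_char_neq0 //.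
by rewrite -cchi.2 mulVg cchi.1.
Qed.

Lemma zeta_root_of (x : K) : x ^+ p = 1 -> x != 1 -> exists m, x ^+ m = zeta.
Proof.
move=> xp x1; have p_gt0 := prime_gt0 prime_p.
have [m xprim mp] := prim_order_exists p_gt0 xp.
have mE : m = p.
  move: mp => /(primeP prime_p).2/orP[/eqP m1|/eqP//].
  by move: (prim_expr_order xprim) x1; rewrite m1 expr1 => ->; rewrite eqxx.
rewrite mE in xprim; have [i ->] := prim_rootP xprim (prim_expr_order zetaP).
by exists i.
Qed.

(** Take a minimal separating set S of characters.  Removing i from S, one
finds an element g on which all the others are trivial but chi_i is not, and a
power of g has chi_i equal to zeta.  Evaluation on S is therefore a bijection
from the group to the S-tuples of p-th roots of unity, whence #|S| = r. *)
Lemma dual_family r (I : finType) (chi : I -> gT -> K) :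
    #|gT| = (p ^ r)%N -> (forall i, is_char (chi i)) ->
    (forall g, (forall i, chi i g = 1) -> g = 1%g) ->
  exists (s : 'I_r -> I) (h : 'I_r -> gT),
    (forall i j, chi (s i) (h j) = zeta ^+ (i == j)) /\
    (forall g, (forall i, chi (s i) g = 1) -> g = 1%g).
Proof.
move=> cardG cchi sep.
pose P (S : {set I}) := [forall g, [forall i in S, chi i g == 1] ==> (g == 1%g)].
have PT : P setT.
  apply/forallP=> g; apply/implyP=> /forall_inP g1; apply/eqP/sep => i.
  by apply/eqP/g1; rewrite inE.
have [S /minsetP[PS minS] _] := minset_exists PT.
pose s (i : 'I_#|S|) := enum_val i.
have sepS g : (forall i, chi (s i) g = 1) -> g = 1%g.
  move=> g1; apply/eqP; move/forallP/(_ g)/implyP: PS; apply.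
  apply/forall_inP=> i Si; apply/eqP.
  by have := g1 (enum_rank_in Si i); rewrite /s enum_rankK_in.
have /fin_all_exists[h hE] (i : 'I_#|S|) :
    exists g, forall j, chi (s j) g = zeta ^+ (j == i).
  have Ssi : s i \in S by apply: enum_valP.
  have : ~~ P (S :\ s i).
    apply/negP=> Pi; have /setP/(_ (s i)) := minS _ Pi (subD1set _ _).
    by rewrite !inE eqxx Ssi.
  rewrite negb_forall => /existsP[g]; rewrite negb_imply => /andP[/forall_inP g1 gn1].
  have gj j : j != i -> chi (s j) g = 1.
    move=> nji; apply/eqP/g1; rewrite !inE enum_valP andbT.
    by apply: contraNneq nji => /enum_val_inj->.
  have gi : chi (s i) g != 1.
    apply: contraNneq gn1 => gi; apply/eqP/sepS => j.
    by have [->|/gj] := eqVneq j i.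
  have [m gm] := zeta_root_of (is_char_root g (cchi (s i))) gi.
  exists (g ^+ m)%g => j; rewrite is_charX //.
  by have [->|/gj ->] := eqVneq j i; rewrite ?gm // expr1n.
have Sr : #|S| = r.
  (* The inverse of evaluation on S, built from the dual elements. *)
  pose Phi (a : {ffun 'I_#|S| -> 'I_p}) : gT := (\prod_j h j ^+ a j)%g.
  have chiPhi a i : chi (s i) (Phi a) = zeta ^+ a i.
    rewrite is_char_prod // (bigD1 i) //= big1 => [|j nji].
      by rewrite mulr1 is_charX // hE eqxx.
    by rewrite is_charX // hE eq_sym (negPf nji) expr1n.
  have PhiI : injective Phi.
    move=> a b ab; apply/ffunP=> i; apply/val_inj/eqP => /=.
    have /eqP := congr1 (chi (s i)) ab; rewrite !chiPhi (eq_prim_root_expr zetaP).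
    by rewrite !modn_small.
  have PhiS g : exists a, Phi a = g.
    have /fin_all_exists[a aE] i : exists a : 'I_p, chi (s i) g = zeta ^+ a.
      by have [a ->] := prim_rootP zetaP (is_char_root g (cchi (s i))); exists a.
    exists (finfun a); apply/eqP; rewrite eq_mulVg1; apply/eqP/sepS => i.
    rewrite (cchi _).2 is_charV // chiPhi ffunE -aE mulVf //; exact: is_char_neq0.
  have : #|{ffun 'I_#|S| -> 'I_p}| = #|gT|.
    have /fin_all_exists[f fK] := PhiS.
    by apply/eqP; rewrite eqn_leq (leq_card _ PhiI) (leq_card _ (can_inj fK)).
  by rewrite card_ffun !card_ord cardG => /eqP; rewrite eqn_exp2l ?prime_gt1 // => /eqP.
clear cardG; move: Sr s sepS h hE; case: r / => s sepS h hE.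
by exists s, h.
Qed.

End Characters.

(** * Fields with an action of (Z/p)^r *)

Lemma has_degree_fin (L : fieldType) (F E : L -> Prop) (I : finType) (e : I -> L) :
    (forall i, E (e i)) ->
    (forall x, E x -> exists2 c : I -> L, (forall i, F (c i)) & x = \sum_i c i * e i) ->
    (forall c : I -> L, (forall i, F (c i)) -> \sum_i c i * e i = 0 ->
      forall i, c i = 0) ->
  has_degree F E #|I|.
Proof.
move=> Ee spanE freeE.
have sumE (c : I -> L) :
    \sum_i c i * e i = \sum_(k < #|I|) c (enum_val k) * e (enum_val k).
  by rewrite (reindex _ (onW_bij _ (@enum_val_bij I))).
exists (fun k => e (enum_val k)); split=> [//|x Ex|c Fc c0 k].
  by have [c Fc ->] := spanE x Ex; exists (fun k => c (enum_val k)); rewrite ?sumE.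
have cI0 : \sum_i c (enum_rank i) * e i = 0.
  by rewrite sumE -[RHS]c0; apply: eq_bigr => l _; rewrite enum_valK.
by have := freeE _ (fun i => Fc _) cI0 (enum_val k); rewrite enum_valK.
Qed.

Section KummerAction.

Variables (p r : nat) (K L : fieldType) (iota : {rmorphism K -> L}) (zeta : K).
Variables (gT : finGroupType) (act : gT -> {rmorphism L -> L}).
Hypotheses (prime_p : prime p) (zetaP : p.-primitive_root zeta).
Hypothesis (charK : p \notin [pchar K]).
Hypotheses (exp_p : forall g : gT, (g ^+ p)%g = 1%g) (cardG : #|gT| = (p ^ r)%N).
Hypothesis actM : forall g h x, act (g * h)%g x = act g (act h x).
Hypothesis act_ground : forall g c, act g (iota c) = iota c.

Definition fixed (x : L) : Prop := forall g, g \in [set: gT] -> act g x = x.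

Definition weight_vector (chi : gT -> K) (x : L) : Prop :=
  forall g, act g x = iota (chi g) * x.

Lemma fixed_subfield : is_subfield fixed.
Proof.
split=> [g _|x y Fx Fy g Gg|x y Fx Fy g Gg|x Fx g Gg].
- exact: rmorph1.
- by rewrite rmorphB Fx ?Fy.
- by rewrite rmorphM Fx ?Fy.
- by rewrite fmorphV Fx.
Qed.

Lemma fixed_ground c : fixed (iota c). Proof. by move=> g _; apply: act_ground. Qed.

Lemma weight_quotient chi x y : (forall g, chi g != 0) ->
  weight_vector chi x -> weight_vector chi y -> fixed (x / y).
Proof.
move=> chi0 wx wy g _; rewrite rmorphM fmorphV wx wy invfM mulrACA divff ?mul1r //.
by rewrite fmorph_eq0.
Qed.

Lemma natK_neq0 : (p ^ r)%:R != 0 :> K.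
Proof.
rewrite natrX expf_neq0 //; apply: contra charK => p0.
by rewrite inE prime_p p0.
Qed.

Section Components.

Variables (y : 'I_r -> L) (chi : 'I_r -> gT -> K) (h : 'I_r -> gT).
Hypotheses (y_neq0 : forall i, y i != 0) (chi_char : forall i, is_char (chi i)).
Hypothesis y_weight : forall i, weight_vector (chi i) (y i).
Hypothesis chi_dual : forall i j, chi i (h j) = zeta ^+ (i == j).
Hypothesis chi_sep : forall g, (forall i, chi i g = 1) -> g = 1%g.

Local Notation exponent := {ffun 'I_r -> 'I_p}.
Implicit Types a b : exponent.

Definition chi_exp a g : K := \prod_i chi i g ^+ a i.
Definition y_exp a : L := \prod_i y i ^+ a i.

(** The projection of x on the eigenspace of weight chi^a. *)
Definition component a x : L :=
  iota (p ^ r)%:R^-1 * \sum_g iota (chi_exp a g)^-1 * act g x.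

Lemma chi_exp_char a : is_char (chi_exp a).
Proof.
split=> [|g k]; first by rewrite /chi_exp big1 // => i _; rewrite (chi_char i).1 expr1n.
by rewrite -big_split; apply: eq_bigr => i _; rewrite (chi_char i).2 exprMn.
Qed.

Lemma chi_exp_neq0 a g : chi_exp a g != 0.
Proof. exact: (is_char_neq0 prime_p exp_p g (chi_exp_char a)). Qed.

Lemma y_exp_neq0 a : y_exp a != 0.
Proof. by apply/prodf_neq0 => i _; rewrite expf_neq0. Qed.

Lemma y_exp_weight a : weight_vector (chi_exp a) (y_exp a).
Proof.
move=> g; rewrite !rmorph_prod -big_split; apply: eq_bigr => i _.
by rewrite !rmorphXn /= y_weight exprMn.
Qed.

(** The sum factors into geometric series, one for each i; the i-th one vanishes
as soon as chi_i(g) is a nontrivial p-th root of unity. *)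
Lemma sum_chi_exp g : \sum_a (chi_exp a g)^-1 = (p ^ r)%:R *+ (g == 1%g).
Proof.
transitivity (\prod_(i < r) \sum_(k < p) (chi i g)^-1 ^+ k).
  rewrite bigA_distr_bigA; apply: eq_bigr => a _.
  by rewrite -prodfV; apply: eq_bigr => i _; rewrite exprVn.
have [->|g1] := eqVneq g 1%g.
  rewrite natrX -[in RHS](card_ord r) -prodr_const; apply: eq_bigr => i _.
  under eq_bigr do rewrite (chi_char i).1 invr1 expr1n.
  by rewrite sumr_const card_ord.
have [i chi1] : exists i, chi i g != 1.
  apply/existsP; apply: contraNT g1; rewrite negb_exists => /forallP g1.
  by apply/eqP/chi_sep => i; apply/eqP; have := g1 i; rewrite negbK.
rewrite (bigD1 i) //= mulr0n.
have /eqP := subrX1 (chi i g)^-1 p.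
rewrite exprVn (is_char_root exp_p) // invr1 subrr eq_sym mulf_eq0 subr_eq0.
by rewrite invr_eq1 (negPf chi1) => /eqP->; rewrite mul0r.
Qed.

(** If a and b differ at j, translating the summation variable by h_j multiplies
the sum by zeta^(a_j - b_j), which is not 1. *)
Lemma chi_exp_orthogonal a b :
  \sum_g (chi_exp b g)^-1 * chi_exp a g = (p ^ r)%:R *+ (a == b).
Proof.
have [->|nab] := eqVneq a b.
  under eq_bigr do rewrite mulVf ?chi_exp_neq0 //.
  by rewrite sumr_const cardT -cardE cardG.
have [j abj] : exists j, a j != b j.
  apply/existsP; apply: contraNT nab; rewrite negb_exists => /forallP ab.
  by apply/eqP/ffunP=> j; apply/eqP; have := ab j; rewrite negbK.
set S := \sum_g _.
have chih c : chi_exp c (h j) = zeta ^+ c j.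
  rewrite /chi_exp (bigD1 j) //= big1 => [|i nij]; first by rewrite chi_dual eqxx mulr1.
  by rewrite chi_dual (negPf nij) expr1n.
have SE : S = (zeta ^+ b j)^-1 * zeta ^+ a j * S.
  rewrite {1}/S (reindex_inj (mulgI (h j))) mulr_sumr; apply: eq_bigr => g _.
  by rewrite !(chi_exp_char _).2 !chih invfM mulrACA.
have z0 : zeta != 0.
  apply/eqP=> z0; have /eqP := prim_expr_order zetaP.
  by rewrite z0 expr0n gtn_eqF ?prime_gt0 // eq_sym oner_eq0.
apply/eqP; rewrite mulr0n; apply: contraTT abj => S0; rewrite negbK.
have /eqP : (zeta ^+ b j)^-1 * zeta ^+ a j = 1.
  by apply: (mulIf S0); rewrite mul1r -SE.
rewrite mulrC -[_ / _ == 1]/(_ == 1) -(inj_eq (mulIf (expf_neq0 (b j) z0))).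
rewrite mulfVK ?expf_neq0 // mul1r (eq_prim_root_expr zetaP) !modn_small //.
Qed.

Lemma component_sum x : \sum_a component a x = x.
Proof.
rewrite -mulr_sumr exchange_big /=.
under eq_bigr do rewrite -mulr_suml -rmorph_sum sum_chi_exp.
rewrite (bigD1 1%g) //= eqxx mulr1n big1 => [|g /negPf->].
  have -> : act 1%g x = x by apply: (fmorph_inj (act 1%g)); rewrite -actM mulg1.
  by rewrite addr0 mulrA -rmorphM mulVf ?natK_neq0 // rmorph1 mul1r.
by rewrite mulr0n rmorph0 mul0r.
Qed.

Lemma component_weight a x : weight_vector (chi_exp a) (component a x).
Proof.
move=> k; rewrite rmorphM act_ground mulrCA; congr (_ * _).
rewrite rmorph_sum mulr_sumr /=.
rewrite [RHS](reindex_inj (mulgI k)); apply: eq_bigr => g _ /=.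
rewrite rmorphM act_ground -actM mulrA -rmorphM (chi_exp_char a).2 invfM.
by rewrite mulVKf // chi_exp_neq0.
Qed.

Lemma component_fixed_comb (c : exponent -> L) b : (forall a, fixed (c a)) ->
  component b (\sum_a c a * y_exp a) = c b * y_exp b.
Proof.
move=> Fc; rewrite /component.
under eq_bigr => g _.
  rewrite rmorph_sum mulr_sumr.
  under eq_bigr => a _ do
    rewrite rmorphM (Fc a) ?inE //= y_exp_weight mulrCA [iota _ * (_ * _)]mulrA -rmorphM.
  over.
rewrite exchange_big /=.
under eq_bigr do rewrite -mulr_sumr -mulr_suml -rmorph_sum chi_exp_orthogonal.
rewrite (bigD1 b) //= eqxx mulr1n big1 => [|a /negPf->].
  by rewrite addr0 mulrCA [iota _ * (_ * _)]mulrA -rmorphM mulVf ?natK_neq0 //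
             rmorph1 mul1r.
by rewrite mulr0n rmorph0 mul0r mulr0.
Qed.

Lemma y_exp_free (c : exponent -> L) : (forall a, fixed (c a)) ->
  \sum_a c a * y_exp a = 0 -> forall a, c a = 0.
Proof.
move=> Fc c0 a; apply/eqP; rewrite -(mulIr_eq0 _ (mulIf (y_exp_neq0 a))).
rewrite -component_fixed_comb // c0 /component big1 ?mulr0 // => g _.
by rewrite rmorph0 mulr0.
Qed.

Lemma component_coef x :
  x = \sum_a (component a x / y_exp a) * y_exp a.
Proof.
rewrite -{1}[x]component_sum; apply: eq_bigr => a _.
by rewrite divfK ?y_exp_neq0.
Qed.

Lemma component_coef_fixed a x : fixed (component a x / y_exp a).
Proof.
exact: weight_quotient (chi_exp_neq0 a) (component_weight a x) (y_exp_weight a).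
Qed.

Lemma component_closed (E : L -> Prop) a x : is_subfield E ->
    sub_set (ground iota) E -> (forall g x, E x -> E (act g x)) ->
  E x -> E (component a x).
Proof.
move=> sfE gE Estable Ex; case: (sfE) => _ _ EM _.
apply: (EM); first by apply: gE; exists (p ^ r)%:R^-1.
apply: subfield_sum => // g _; apply: EM; last exact: Estable.
by apply: gE; exists (chi_exp a g)^-1.
Qed.

Lemma fixed_degree : has_degree fixed (@full_field L) #|exponent|.
Proof.
apply: (@has_degree_fin _ _ _ _ y_exp) => [//|x _|]; last exact: y_exp_free.
exists (fun a => component a x / y_exp a); last exact: component_coef.
by move=> a; apply: component_coef_fixed.
Qed.

Definition y_field : L -> Prop :=
  gen_field (fun x => ground iota x \/ exists i, x = y i).

Definition y_fixed (x : L) : Prop := y_field x /\ fixed x.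

Lemma y_field_subfield : is_subfield y_field. Proof. exact: gen_field_subfield. Qed.

Lemma y_field_ground : sub_set (ground iota) y_field.
Proof. by move=> x gx; apply: sub_gen_field; left. Qed.

Lemma y_field_y i : y_field (y i).
Proof. by apply: sub_gen_field; right; exists i. Qed.

Lemma y_field_exp a : y_field (y_exp a).
Proof.
apply: subfield_prod y_field_subfield _ => i _.
exact: subfield_exp y_field_subfield (y_field_y i).
Qed.

Lemma y_field_stable g x : y_field x -> y_field (act g x).
Proof.
have [E1 EB EM EV] := y_field_subfield.
move: x; apply: gen_field_min => [|x [[c ->]|[i ->]]].
- split=> [|x z|x z|x]; rewrite ?rmorph1 ?rmorphB ?rmorphM ?fmorphV //.
  + exact: EB.
  + exact: EM.
  + exact: EV.
- by rewrite act_ground; apply: y_field_ground; exists c.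
- rewrite y_weight; apply: EM; last exact: y_field_y.
  by apply: y_field_ground; exists (chi i g).
Qed.

Lemma y_fixed_coef a x : y_field x -> y_fixed (component a x / y_exp a).
Proof.
move=> Ex; split; last exact: component_coef_fixed.
have [_ _ EM EV] := y_field_subfield.
apply: (EM); last by apply: EV; apply: y_field_exp.
apply: component_closed y_field_subfield y_field_ground _ Ex.
exact: y_field_stable.
Qed.

Lemma y_fixed_subfield : is_subfield y_fixed.
Proof.
have [E1 EB EM EV] := y_field_subfield.
have [F1 FB FM FV] := fixed_subfield.
split=> [|x z [? ?] [? ?]|x z [? ?] [? ?]|x [? ?]]; split; auto.
Qed.

(** The components of an element of E = K(y) lie in E, as E is G-stable and
contains K.  So the decomposition of L along the monomials y^a over
the fixed field restricts to one of E over E_0, with the same basis. *)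
Lemma y_fixed_intermediate : intermediate_def_field iota fixed y_fixed.
Proof.
split; [exact: y_fixed_subfield| |by move=> x []|].
  move=> x gx; split; first exact: y_field_ground.
  by case: gx => c ->; apply: fixed_ground.
exists y_field; split=> [|x []//||x _]; first exact: y_field_subfield.
  exists #|exponent|; first exact: fixed_degree.
  apply: (@has_degree_fin _ _ _ _ y_exp) => [a|x Ex|c Fc].
  - exact: y_field_exp.
  - exists (fun a => component a x / y_exp a); last exact: component_coef.
    by move=> a; apply: y_fixed_coef.
  - by apply: y_exp_free => a; case: (Fc a).
rewrite [x]component_coef.
have sfC := gen_field_subfield (fun z => y_field z \/ fixed z).
apply: (subfield_sum _ sfC) => a _.
case: (sfC) => _ _ CM _; apply: CM; apply: sub_gen_field.
  by right; apply: component_coef_fixed.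
by left; apply: y_field_exp.
Qed.

(** E is algebraic over K(y_1^p, ..., y_r^p), each y_i being a root of
X^p - y_i^p. *)
Lemma y_fixed_trdeg :
  alg_independent iota (fun i => y i ^+ p) -> has_trdeg iota y_fixed r.
Proof.
move=> indt; exists (fun i => y i ^+ p); split=> // [i|x [Ex _]].
  split; first exact: subfield_exp y_field_subfield (y_field_y i).
  move=> g _; rewrite rmorphXn /= y_weight exprMn -rmorphXn.
  by rewrite (is_char_root exp_p) // rmorph1 mul1r.
pose t i := y i ^+ p.
have sfA := alg_over_subfield iota (fun x => exists i, x = t i).
move: x Ex; apply: (gen_field_min sfA) => x [[c ->]|[i ->]].
  exact: alg_over_ground.
have p_gt0 := prime_gt0 prime_p.
exists ('X^p - (t i)%:P); split.
- by rewrite -size_poly_eq0 size_XnsubC.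
- have sfT := gen_field_subfield (fun x => ground iota x \/ exists i, x = t i).
  case: (sfT) => T1 TB _ _.
  have T0 : gen_field (fun x => ground iota x \/ exists i, x = t i) 0.
    by rewrite -(subrr 1); apply: TB.
  have Tt : gen_field (fun x => ground iota x \/ exists i, x = t i) (t i).
    by apply: sub_gen_field; right; exists i.
  move=> k; rewrite coefB coefXn coefC.
  by apply: TB; [case: eqP | case: ifP].
- by apply/rootP; rewrite !hornerE subrr.
Qed.

End Components.

Lemma zeta_expz_eq1 (n : int) : zeta ^ n = 1 -> (p %| `|n|)%N.
Proof.
by case: n => n /eqP; rewrite /exprz ?invr_eq1 -(prim_order_dvd zetaP).
Qed.

Section ValueMapBound.

Variables (Gamma : zmodType) (v : L -> Gamma).
Hypothesis vmap : value_map iota v.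
Hypothesis v_rigid : forall g x c, x != 0 -> v x = 0 -> act g x = iota c * x -> c = 1.
Hypothesis v_torsion : forall w : Gamma, w *+ p = 0 -> w = 0.

(** Given a relation with coefficients a_i, the product x of the z_i^(a_i) has
value 0, so that its weight is trivial; at h_j this weight is zeta^(a_j), so p
divides every a_j.  As there is no p-torsion, the a_j / p are again the
coefficients of a relation, and every power of p divides every a_j. *)
Lemma dual_weights_independent (z : 'I_r -> L) (psi : 'I_r -> gT -> K)
    (h : 'I_r -> gT) :
    (forall i, z i != 0) -> (forall i, weight_vector (psi i) (z i)) ->
    (forall i j, psi i (h j) = zeta ^+ (i == j)) ->
  int_independent (fun i => v (z i)).
Proof.
move=> z0 wz dual.
(* One step of the descent. *)
have divp a : \sum_i v (z i) *~ a i = 0 -> forall j, (p %| `|a j|)%N.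
  move=> az j; pose x := \prod_i z i ^ a i.
  have zX0 i : z i ^ a i != 0 by rewrite expfz_eq0 negb_and z0 orbT.
  apply: zeta_expz_eq1; apply: (v_rigid (g := h j) (x := x)).
  - by apply/prodf_neq0 => i _; apply: zX0.
  - rewrite (value_prod vmap) // -[RHS]az; apply: eq_bigr => i _.
    exact: (valueXz vmap).
  - rewrite rmorph_prod (bigD1 j) //= /x [in RHS](bigD1 j) //= mulrA.
    congr (_ * _).
      by rewrite fmorphXz /= wz dual eqxx expr1 expfzMl fmorphXz.
    apply: eq_bigr => i nij.
    by rewrite fmorphXz /= wz dual (negPf nij) rmorph1 mul1r.
have divpX N : forall a, \sum_i v (z i) *~ a i = 0 -> forall j, (p ^ N %| `|a j|)%N.
  elim: N => [|N IHN] a az j; first exact: dvd1n.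
  pose b i := (a i %/ p)%Z.
  have ab i : a i = b i * p by rewrite divzK //; apply: divp.
  have bz : \sum_i v (z i) *~ b i = 0.
    apply: v_torsion; rewrite -sumrMnl -[RHS]az; apply: eq_bigr => i _.
    by rewrite ab mulrzA pmulrn.
  by rewrite ab abszM expnSr dvdn_mul // IHN.
move=> a az j; apply/eqP; rewrite -absz_eq0; apply: contraT; rewrite -lt0n => a0.
have := dvdn_leq a0 (divpX `|a j|%N a az j).
by rewrite leqNgt ltn_expl // prime_gt1.
Qed.

Section DimensionBound.

Variables (y : 'I_r -> L) (chi : 'I_r -> gT -> K) (h : 'I_r -> gT).
Hypotheses (y_neq0 : forall i, y i != 0) (chi_char : forall i, is_char (chi i)).
Hypothesis y_weight : forall i, weight_vector (chi i) (y i).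
Hypothesis chi_dual : forall i j, chi i (h j) = zeta ^+ (i == j).
Hypothesis chi_sep : forall g, (forall i, chi i g = 1) -> g = 1%g.

Lemma algebraic_stable (E0 : L -> Prop) g x :
  sub_set E0 fixed -> is_algebraic E0 x -> is_algebraic E0 (act g x).
Proof.
move=> E0F [q [q0 E0q qx0]]; exists q; split=> //.
have <- : map_poly (act g) q = q.
  by apply/polyP=> k; rewrite coef_map /= (E0F _ (E0q k)) ?inE.
by rewrite fmorph_root.
Qed.

(** The algebraic closure A of E_0 in L is G-stable, and G acts faithfully
on it as E and the fixed field together generate L.  So A contains eigenvectors
whose weights separate G, and r of them with dual weights, which are
algebraically independent while A is algebraic over the d elements t. *)
Lemma trdeg_lower_bound (E0 : L -> Prop) d :
  intermediate_def_field iota fixed E0 -> has_trdeg iota E0 d -> (r <= d)%N.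
Proof.
move=> [sfE0 gE0 E0F [E [sfE E0E [deg _ degE] compE]]] [t [E0t _ algE0]].
pose A := is_algebraic E0.
have sfA : is_subfield A := is_algebraic_subfield sfE0.
have gA : sub_set (ground iota) A by move=> x /gE0; apply: is_algebraic_self.
have EA : sub_set E A by move=> x; apply: finite_degree_algebraic sfE0 sfE degE.
(* No g != 1 fixes E, since E and the fixed field generate the y_i. *)
have moved g : g != 1%g -> exists2 x, E x & act g x != x.
  move=> g1; apply: contrapT => noE; move/eqP: g1; apply; apply: chi_sep => i.
  have : gen_field (fun x => E x \/ fixed x) (y i) by apply: compE.
  have sf_g : is_subfield (fun x => act g x = x).
    split=> [|x z gx gz|x z gx gz|x gx]; first exact: rmorph1.
    - by rewrite rmorphB gx gz.
    - by rewrite rmorphM gx gz.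
    - by rewrite fmorphV gx.
  move=> /(_ _ sf_g) gy; apply: (fmorph_inj iota); apply: (mulIf (y_neq0 i)).
  rewrite -y_weight rmorph1 mul1r; apply: gy => x [Ex|Fx]; last by rewrite Fx ?inE.
  by apply/eqP; apply: contraT => gx; case: noE; exists x.
have /fin_all_exists[psi] g : exists (psi : gT -> K), exists z,
    [/\ is_char psi, A z, z != 0, weight_vector psi z & g != 1%g -> psi g != 1].
  have [g1|g1] := eqVneq g 1%g.
    exists (fun=> 1), 1; split; rewrite ?oner_eq0 //.
    - by split=> // k l; rewrite mulr1.
    - by case: sfA.
    - by move=> k; rewrite !rmorph1 mulr1.
  have [x Ex gx] := moved g g1.
  have [a ga] : exists a, act g (component chi a x) != component chi a x.
    apply/existsP; apply: contraNT gx; rewrite negb_exists => /forallP gx.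
    rewrite -[x](component_sum chi_char chi_sep) rmorph_sum.
    by apply/eqP/eq_bigr => a _; apply/eqP; have := gx a; rewrite negbK.
  exists (chi_exp chi a), (component chi a x); split.
  - exact: chi_exp_char.
  - apply: (component_closed chi a sfA gA) (EA _ Ex).
    by move=> k z; apply: algebraic_stable.
  - by apply: contraNneq ga => ->; rewrite rmorph0.
  - exact: component_weight.
  - move=> _; apply: contraNneq ga => ga.
    by rewrite (component_weight chi_char) ga rmorph1 mul1r.
case/fin_all_exists=> z /all_and5[psi_char Az z0 wz psi1].
have psi_sep g : (forall k, psi k g = 1) -> g = 1%g.
  by move=> g1; apply/eqP; apply: contraT => /psi1; rewrite g1 eqxx.
have [s [k [psi_dual _]]] := dual_family prime_p zetaP exp_p cardG psi_char psi_sep.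
have indz : int_independent (fun i => v (z (s i))).
  by apply: (dual_weights_independent (fun i => z0 (s i)) (fun i => wz (s i))) psi_dual.
apply: (steinitz (iota := iota) (z := fun i => z (s i)) (t := t)) => i.
  exact: (int_independent_transcendental vmap).
exact: is_algebraic_trans (gen_field_subfield _) sfE0 algE0 (Az (s i)).
Qed.

Lemma has_ed_fixed : has_ed iota fixed r.
Proof.
split=> [|E0 d]; last exact: trdeg_lower_bound.
exists (y_fixed y).
  exact: y_fixed_intermediate y_neq0 chi_char y_weight chi_dual chi_sep.
apply: (y_fixed_trdeg chi_char) => //.
have indy := dual_weights_independent y_neq0 y_weight chi_dual.
apply: (int_independent_alg vmap) => [i|a az i]; first by rewrite expf_neq0.
have /indy : \sum_i v (y i) *~ (a i * p) = 0.
  rewrite -[RHS]az; apply: eq_bigr => j _.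
  by rewrite (valueX vmap) // mulrC mulrzA pmulrn.
move=> /(_ i)/eqP; rewrite mulf_eq0 => /orP[/eqP//|].
by rewrite eqz_nat gtn_eqF ?prime_gt0.
Qed.

End DimensionBound.

End ValueMapBound.

End KummerAction.

(** * The action on rational functions and its invariant valuation *)

Section LinearSubstitution.

Variables (K : fieldType) (n : nat).
Implicit Types (A B : 'M[K]_n) (f : {mpoly K[n]}).

Definition lin_subst A : {mpoly K[n]} -> {mpoly K[n]} :=
  comp_mpoly [tuple \sum_(j < n) A j i *: 'X_j | i < n].

HB.instance Definition _ A := GRing.RMorphism.on (lin_subst A).

Lemma lin_substC A c : lin_subst A c%:MP = c%:MP.
Proof. exact: comp_mpolyC. Qed.

Lemma lin_substZ A c f : lin_subst A (c *: f) = c *: lin_subst A f.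
Proof. exact: comp_mpolyZ. Qed.

Lemma lin_substX A i : lin_subst A 'X_i = \sum_j A j i *: 'X_j.
Proof. by rewrite /lin_subst comp_mpolyXU -tnth_nth tnth_mktuple. Qed.

Lemma lin_substXm A m : lin_subst A 'X_[m] = \prod_i lin_subst A 'X_i ^+ m i.
Proof. by rewrite mpolyXE_id rmorph_prod; apply: eq_bigr => i _; rewrite rmorphXn. Qed.

Lemma lin_substE A f : lin_subst A f = \sum_(m <- msupp f) f@_m *: lin_subst A 'X_[m].
Proof. by rewrite {1}[f]mpolyE rmorph_sum; apply: eq_bigr => m _; rewrite /= lin_substZ. Qed.

Lemma lin_substM A B f : lin_subst A (lin_subst B f) = lin_subst (A *m B) f.
Proof.
rewrite [lin_subst B f]lin_substE [RHS]lin_substE rmorph_sum.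
apply: eq_bigr => m _; rewrite /= lin_substZ !lin_substXm rmorph_prod.
congr (_ *: _); apply: eq_bigr => i _; rewrite rmorphXn /= !lin_substX rmorph_sum.
congr (_ ^+ _); under eq_bigr do rewrite /= lin_substZ lin_substX scaler_sumr.
rewrite exchange_big; apply: eq_bigr => k _ /=; rewrite mxE scaler_suml.
by apply: eq_bigr => j _; rewrite scalerA mulrC.
Qed.

Lemma lin_subst_diag_coef (d : 'rV[K]_n) f m :
  (lin_subst (diag_mx d) f)@_m = (\prod_i d 0 i ^+ m i) * f@_m.
Proof.
have monE k : lin_subst (diag_mx d) 'X_[k] = (\prod_i d 0 i ^+ k i) *: 'X_[k].
  rewrite lin_substXm [in RHS]mpolyXE_id -scaler_prod; apply: eq_bigr => i _.
  rewrite lin_substX (bigD1 i) //= big1 => [|j nij]; last first.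
    by rewrite mxE (negPf nij) mulr0n scale0r.
  by rewrite addr0 mxE eqxx mulr1n exprZn.
rewrite lin_substE [in RHS](mpolyE f) !raddf_sum mulr_sumr; apply: eq_bigr => k _.
rewrite /= monE !mcoeffZ mcoeffX; case: eqP => [->|]; first by rewrite !mulr1 mulrC.
by rewrite !mulr0.
Qed.

Lemma lin_subst1 f : lin_subst 1%:M f = f.
Proof.
apply/mpolyP=> m; rewrite -diag_const_mx lin_subst_diag_coef big1 ?mul1r // => i _.
by rewrite mxE expr1n.
Qed.

Lemma lin_substK A : A \in unitmx -> cancel (lin_subst A) (lin_subst (invmx A)).
Proof. by move=> uA f; rewrite lin_substM mulVmx // lin_subst1. Qed.

Lemma lin_substVK A : A \in unitmx -> cancel (lin_subst (invmx A)) (lin_subst A).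
Proof. by move=> uA f; rewrite lin_substM mulmxV // lin_subst1. Qed.

End LinearSubstitution.

Section RationalAction.

Variables (K : fieldType) (n : nat) (gT : finGroupType).
Variable rG : mx_representation K [set: gT]%G n.

Lemma ratfunP (x : ratfun K n) : exists a b, b != 0 /\ x = a%:F / b%:F.
Proof.
exists (\n_(repr x)), (\d_(repr x)); have d0 := denom_ratioP (repr x).
by split=> //; rewrite -repr_frac mulfK // tofrac_eq0.
Qed.

Lemma polyactE g f : polyact rG g f = lin_subst (rG g) f.
Proof. by []. Qed.

Lemma ratactE g a b : b != 0 ->
  ratact rG g (a%:F / b%:F) = (polyact rG g a)%:F / (polyact rG g b)%:F.
Proof. by move=> b0; rewrite ratact_div ?inE. Qed.

Lemma polyact_neq0 g f : f != 0 -> (polyact rG g f)%:F != 0.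
Proof. by move=> f0; rewrite tofrac_eq0 polyact_eq0 ?inE. Qed.

Lemma sub_fractions (F : fieldType) (a b c d : F) : b != 0 -> d != 0 ->
  a / b - c / d = (a * d - c * b) / (b * d).
Proof. by move=> b0 d0; field; apply/andP. Qed.

Lemma ratact_additive g : zmod_morphism (ratact rG g).
Proof.
move=> x z; have [[a [b [b0 ->]]] [c [d [d0 ->]]]] := (ratfunP x, ratfunP z).
have bF : b%:F != 0 by rewrite tofrac_eq0.
have dF : d%:F != 0 by rewrite tofrac_eq0.
rewrite (ratactE g a b0) (ratactE g c d0) (sub_fractions _ _ bF dF).
rewrite (sub_fractions _ _ (polyact_neq0 g b0) (polyact_neq0 g d0)).
rewrite -!tofracM -!tofracB (ratactE g _ (mulf_neq0 b0 d0)).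
by congr (_%:F / _%:F); rewrite !polyactE ?rmorphB !rmorphM.
Qed.

Lemma ratact_multiplicative g : monoid_morphism (ratact rG g).
Proof.
split=> [|x z].
  have -> : (1 : ratfun K n) = (1 : {mpoly K[n]})%:F / (1 : {mpoly K[n]})%:F.
    by rewrite tofrac1 divr1.
  by rewrite ratactE ?oner_eq0 // polyactE rmorph1.
have [[a [b [b0 ->]]] [c [d [d0 ->]]]] := (ratfunP x, ratfunP z).
rewrite (ratactE g a b0) (ratactE g c d0) !mulf_div -!tofracM.
rewrite (ratactE g _ (mulf_neq0 b0 d0)).
by congr (_%:F / _%:F); rewrite !polyactE rmorphM.
Qed.

HB.instance Definition _ g :=
  GRing.isZmodMorphism.Build _ _ (ratact rG g) (ratact_additive g).
HB.instance Definition _ g :=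
  GRing.isMonoidMorphism.Build _ _ (ratact rG g) (ratact_multiplicative g).

Lemma ratactF g f : ratact rG g f%:F = (polyact rG g f)%:F.
Proof.
have -> : f%:F = f%:F / (1 : {mpoly K[n]})%:F :> ratfun K n by rewrite tofrac1 divr1.
by rewrite ratactE ?oner_eq0 // [polyact _ _ 1]polyactE rmorph1 tofrac1 divr1.
Qed.

Lemma ratactM g h x : ratact rG (g * h)%g x = ratact rG g (ratact rG h x).
Proof.
have [a [b [b0 ->]]] := ratfunP x.
have hb0 : polyact rG h b != 0 by rewrite polyact_eq0 ?inE.
rewrite (ratactE h a b0) (ratactE g _ hb0) (ratactE _ a b0).
have hM f : polyact rG (g * h)%g f = polyact rG g (polyact rG h f).
  by rewrite polyactM ?inE.
by rewrite !hM.
Qed.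

Lemma ratact_ground g c : ratact rG g (ratfunC K n c) = ratfunC K n c.
Proof. by rewrite [LHS]ratactF polyactE lin_substC. Qed.

End RationalAction.

Lemma ratfun_common_denominator (K : fieldType) n (x z : ratfun K n) :
  exists a b c, [/\ c != 0, x = a%:F / c%:F & z = b%:F / c%:F].
Proof.
have [[a [b [b0 ->]]] [c [d [d0 ->]]]] := (ratfunP x, ratfunP z).
have common (F : fieldType) (u w e : F) : e != 0 -> u / w = (u * e) / (w * e).
  by move=> e0; rewrite invfM mulrACA divff // mulr1.
have bF : b%:F != 0 by rewrite tofrac_eq0.
have dF : d%:F != 0 by rewrite tofrac_eq0.
exists (a * d), (c * b), (b * d); split; first exact: mulf_neq0.
  by rewrite (common _ _ _ _ dF) -!tofracM.
by rewrite (common _ _ _ _ bF) -!tofracM [b * d]mulrC.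
Qed.

Section LeadingExponent.

Variables (K : fieldType) (n : nat) (P : 'M[K]_n).
Hypothesis unitP : P \in unitmx.
Implicit Types a b f : {mpoly K[n]}.

Lemma lin_subst_eq0 f : (lin_subst P f == 0) = (f == 0).
Proof.
apply/eqP/eqP=> [f0|->]; last exact: rmorph0.
by rewrite -[f](lin_substK unitP) f0 rmorph0.
Qed.

(** Meant for a P that diagonalises the group, so that leading exponents, taken
after the substitution, are preserved by the action. *)
Definition poly_exponent f : 'rV[int]_n := \row_i (mlead (lin_subst P f) i)%:Z.

Definition lead_exponent (x : ratfun K n) : 'rV[int]_n :=
  poly_exponent \n_(repr x) - poly_exponent \d_(repr x).

Lemma poly_exponentM a b : a != 0 -> b != 0 ->
  poly_exponent (a * b) = poly_exponent a + poly_exponent b.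
Proof.
move=> a0 b0; apply/rowP=> i; rewrite !mxE rmorphM /= mleadM ?lin_subst_eq0 //.
by rewrite mnmDE PoszD.
Qed.

Lemma poly_exponent_inj a b : poly_exponent a = poly_exponent b ->
  mlead (lin_subst P a) = mlead (lin_subst P b).
Proof.
move=> ab; apply/mnmP=> i; move/rowP/(_ i): ab; rewrite !mxE => /eqP.
by rewrite eqz_nat => /eqP.
Qed.

Lemma lead_exponent_frac a b : a != 0 -> b != 0 ->
  lead_exponent (a%:F / b%:F) = poly_exponent a - poly_exponent b.
Proof.
move=> a0 b0; rewrite /lead_exponent; set x := a%:F / b%:F.
have d0 : \d_(repr x) != 0 := denom_ratioP (repr x).
have e : a * \d_(repr x) = b * \n_(repr x).
  apply/eqP; rewrite -tofrac_eq !rmorphM /= -repr_frac mulrA; apply/eqP.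
  by congr (_ * _); rewrite /x mulrC divfK // tofrac_eq0.
have n0 : \n_(repr x) != 0.
  by apply: contraNneq (mulf_neq0 a0 d0) => n0; rewrite e n0 mulr0.
have eD (V : zmodType) (s t u w : V) : s + w = t + u -> u - w = s - t.
  by move=> stuw; rewrite -[u](addKr t) -stuw addrA addrK addrC.
apply: eD; rewrite -(poly_exponentM a0 d0) -(poly_exponentM b0 n0).
exact: congr1.
Qed.

Lemma num_neq0 a b : a%:F / b%:F != 0 :> ratfun K n -> a != 0.
Proof. by apply: contraNneq => ->; rewrite tofrac0 mul0r. Qed.

Lemma lead_exponent_value_map : value_map (ratfunC K n) lead_exponent.
Proof.
split=> [x z|x z|c c0].
- have [[a [b [b0 ->]]] [c [d [d0 ->]]]] := (ratfunP x, ratfunP z).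
  move=> /num_neq0 a0 /num_neq0 c0.
  rewrite mulf_div -!tofracM !lead_exponent_frac ?mulf_neq0 // !poly_exponentM //.
  by rewrite opprD addrACA.
- have [a [b [c [c0 -> ->]]]] := ratfun_common_denominator x z.
  move=> /num_neq0 a0 /num_neq0 b0; rewrite !lead_exponent_frac // => vab.
  have lab : mlead (lin_subst P a) != mlead (lin_subst P b).
    by apply: contraNneq vab => lab; rewrite {1}/poly_exponent lab.
  have ab0 : a + b != 0.
    apply: contraNneq lab => /eqP; rewrite addr_eq0 => /eqP->.
    by rewrite rmorphN mleadN.
  rewrite -mulrDl -tofracD lead_exponent_frac // mulf_neq0 ?invr_eq0 ?tofrac_eq0 //.
  split=> //; rewrite /poly_exponent rmorphD /=.
  case: (ltgtP (mlead (lin_subst P a)) (mlead (lin_subst P b))) lab => // lt _.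
    by right; rewrite mleadDr.
  by left; rewrite mleadDl.
- have -> : ratfunC K n c = (c%:MP)%:F / (1 : {mpoly K[n]})%:F by rewrite tofrac1 divr1.
  rewrite lead_exponent_frac ?mpolyC_eq0 ?oner_eq0 //; apply/rowP=> i.
  by rewrite !mxE lin_substC rmorph1 mleadC mlead1 subrr.
Qed.

Lemma mlead_diag_le (d : 'rV[K]_n) f : (mlead (lin_subst (diag_mx d) f) <= mlead f)%O.
Proof.
have [->|f0] := eqVneq (lin_subst (diag_mx d) f) 0; first by rewrite mlead0 le0x.
apply: msupp_le_mlead; have := mlead_supp f0.
rewrite !mcoeff_msupp lin_subst_diag_coef; apply: contraNneq => ->.
by rewrite mulr0.
Qed.

(** Let A and B be numerator and denominator in eigencoordinates.  As x has
value 0, both have the same leading monomial m, and g multiplies both leading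
coefficients by the same factor d^m.  Compare the coefficients of m + m
in (g A) B = c A (g B). *)
Lemma lead_exponent_rigid (gT : finGroupType) (rG : mx_representation K [set: gT]%G n)
    (d : gT -> 'rV[K]_n) g x c :
    (forall g, P *m rG g = diag_mx (d g) *m P) -> (forall g i, d g 0 i != 0) ->
    x != 0 -> lead_exponent x = 0 -> ratact rG g x = ratfunC K n c * x ->
  c = 1.
Proof.
move=> diagP d0; have [a [b [b0 ->]]] := ratfunP x => /num_neq0 a0.
rewrite lead_exponent_frac // => /eqP; rewrite subr_eq0 => /eqP/poly_exponent_inj lab.
rewrite ratactE // => E.
have clear_denominators (F : fieldType) (s t u w e : F) :
    t != 0 -> w != 0 -> s / t = e * (u / w) -> s * w = e * u * t.
  by move=> t0 w0 stuw; rewrite -[s](divfK t0) stuw; field.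
have bF : b%:F != 0 by rewrite tofrac_eq0.
have {}E : polyact rG g a * b = c%:MP * a * polyact rG g b.
  apply/eqP; rewrite -tofrac_eq !tofracM; apply/eqP.
  exact: clear_denominators (polyact_neq0 rG g b0) bF E.
have phiE f : lin_subst P (polyact rG g f) = lin_subst (diag_mx (d g)) (lin_subst P f).
  by rewrite polyactE !lin_substM diagP.
have := congr1 (lin_subst P) E; rewrite !rmorphM /= !phiE lin_substC.
set A := lin_subst P a; set B := lin_subst P b; rewrite -mulrA mul_mpolyC.
have leB : (mlead B <= mlead A)%O by rewrite /A lab.
have leDA := mlead_diag_le (d g) A.
have leDB := le_trans (mlead_diag_le (d g) B) leB.
move=> /(congr1 (mcoeff (mlead A + mlead A)%MM)); rewrite mcoeffZ.
rewrite (mleadcMW leDA leB) (mleadcMW (lexx _) leDB) 2!lin_subst_diag_coef.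
set w := \prod_i _ => AB.
have w0 : w != 0 by apply/prodf_neq0 => i _; rewrite expf_neq0.
have A0 : A@_(mlead A) != 0 by rewrite mleadc_eq0 lin_subst_eq0.
have B0 : B@_(mlead A) != 0 by rewrite /A lab mleadc_eq0 lin_subst_eq0.
apply/esym/(mulIf (mulf_neq0 w0 (mulf_neq0 A0 B0))).
by rewrite mul1r [LHS]mulrA AB [A@_ _ * (w * _)]mulrCA.
Qed.

End LeadingExponent.

(** * Representations of elementary abelian groups *)

Section ElementaryAbelian.

Variables (p : nat) (K : fieldType) (zeta : K) (gT : finGroupType).
Hypotheses (prime_p : prime p) (zetaP : p.-primitive_root zeta).
Hypothesis (exp_p : forall g : gT, (g ^+ p)%g = 1%g).

Lemma root_of_unity_diagonalizable n (A : 'M[K]_n.+1) : A ^+ p = 1 -> diagonalizable A.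
Proof.
move=> Ap; apply/diagonalizableP; exists [seq zeta ^+ i | i <- index_iota 0 p].
  rewrite map_inj_in_uniq ?iota_uniq // => i j.
  rewrite !mem_index_iota /= => ltip ltjp /eqP.
  by rewrite (eq_prim_root_expr zetaP) !modn_small // => /eqP.
rewrite big_map (factor_Xn_sub_1 zetaP); apply: mxminpoly_min.
by rewrite rmorphB rmorphXn /= horner_mx_X rmorph1 Ap subrr.
Qed.

Lemma simultaneous_diagonalization n (rG : mx_representation K [set: gT]%G n) :
    (forall g h : gT, commute g h) ->
  exists2 P, P \in unitmx & exists d : gT -> 'rV[K]_n,
    forall g, P *m rG g = diag_mx (d g) *m P.
Proof.
move=> abG.
have diagG g : diagonalizable (rG g).
  case: n rG => [|m] rG'; first by rewrite thinmx0; apply: diagonalizable0.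
  apply: root_of_unity_diagonalizable.
  by rewrite -(repr_mxX rG') ?inE // exp_p (repr_mx1 rG').
have [P unitP /allP diagP] : codiagonalizable [seq rG g | g <- enum gT].
  apply/codiagonalizableP; split=> [A B /mapP[g _ ->] /mapP[h _ ->]|A /mapP[g _ ->] //].
  by rewrite /comm_mx -!(repr_mxM rG) ?inE // abG.
have /fin_all_exists[d dE] g : exists d : 'rV[K]_n, P *m rG g = diag_mx d *m P.
  have /diagP/diagonalizable_forPex[d /(simmxP unitP) dE] :
      rG g \in [seq rG g | g <- enum gT].
    by apply: map_f; rewrite mem_enum.
  by exists d.
by exists P => //; exists d.
Qed.

(** In eigencoordinates the coordinate functions are eigenvectors, and their
weights separate G because the representation is faithful. *)
Lemma has_edG_elementary_abelian r :
    p \notin [pchar K] -> (forall g h : gT, commute g h) -> #|gT| = (p ^ r)%N ->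
  has_edG K [set: gT]%G r.
Proof.
move=> charK abG cardG n rG faithG.
have [P unitP [d dE]] := simultaneous_diagonalization rG abG.
pose chi (i : 'I_n) g := d g 0 i.
have diagE g : diag_mx (d g) = P *m rG g *m invmx P by rewrite dE mulmxK.
have chi_char i : is_char (chi i).
  have chiE g : chi i g = diag_mx (d g) i i by rewrite mxE eqxx mulr1n.
  split=> [|g h]; rewrite !chiE.
    by rewrite diagE (repr_mx1 rG) mulmx1 mulmxV // mxE eqxx.
  have -> : diag_mx (d (g * h)%g) = diag_mx (d g) *m diag_mx (d h).
    by rewrite !diagE (repr_mxM rG) ?inE // !mulmxA mulmxKV.
  by rewrite mul_diag_mx !mxE eqxx !mulr1n.
have chi_sep g : (forall i, chi i g = 1) -> g = 1%g.
  move=> g1; apply/set1P; apply: (subsetP faithG); apply/rkerP; rewrite inE; split=> //.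
  have dg1 : diag_mx (d g) = 1%:M.
    by rewrite -diag_const_mx; congr diag_mx; apply/rowP=> i; rewrite mxE; apply: g1.
  by rewrite -[rG g](mulKmx unitP) dE dg1 mul1mx mulVmx.
have [s [h [dual sep]]] := dual_family prime_p zetaP exp_p cardG chi_char chi_sep.
pose y (i : 'I_r) : ratfun K n := (lin_subst (invmx P) 'X_(s i))%:F.
have y0 i : y i != 0.
  rewrite tofrac_eq0 -(lin_subst_eq0 unitP) lin_substVK //.
  by rewrite -msupp_eq0 msuppX.
have wy i : weight_vector (ratfunC K n) (ratact rG) (chi (s i)) (y i).
  move=> g; rewrite -[LHS]/(ratact rG g (y i)) ratactF -[RHS]tofracM polyactE.
  congr (_%:F).
  apply: (can_inj (lin_substK unitP)); rewrite lin_substM dE -lin_substM.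
  rewrite rmorphM /= lin_substC !lin_substVK //.
  apply/mpolyP=> m; rewrite lin_subst_diag_coef mul_mpolyC mcoeffZ mcoeffX.
  have [<-|] := eqVneq; last by rewrite !mulr0.
  rewrite !mulr1 (bigD1 (s i)) //= big1 => [|j nij]; last first.
    by rewrite mnm1E eq_sym (negPf nij).
  by rewrite mnm1E eqxx expr1 mulr1.
apply: (has_ed_fixed (act := ratact rG) prime_p zetaP charK exp_p cardG _ _
  (lead_exponent_value_map unitP) _ _ y0 (fun i => chi_char (s i)) wy dual sep).
- exact: ratactM.
- exact: ratact_ground.
- move=> g x c; apply: (lead_exponent_rigid unitP dE) => k i.
  exact: (is_char_neq0 prime_p exp_p k (chi_char i)).
- move=> w /rowP wp; apply/rowP=> i; have := wp i; rewrite mulmxnE !mxE => /eqP.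
  by rewrite -mulr_natr natz mulf_eq0 eqz_nat gtn_eqF ?prime_gt0 // orbF => /eqP.
Qed.

End ElementaryAbelian.

Theorem theorem1p1 (p : nat) (K : fieldType) (zeta : K) (r : nat)
  (prime_p : prime p) (charK : p \notin [pchar K])
  (zetaP : p.-primitive_root zeta) (r_gt0 : (0 < r)%N) :
  has_edG K [set: 'rV['Z_p]_r]%G r.
Proof.
have Zp : (Zp_trunc p).+2 = p by rewrite Zp_cast ?prime_gt1.
apply: (has_edG_elementary_abelian prime_p zetaP) => // [g|g h|].
- rewrite FinRing.zmodXgE; apply/rowP=> i; rewrite mulmxnE mxE -mulr_natr.
  by rewrite pchar_Zp ?prime_gt1 // mulr0.
- exact: FinRing.zmod_mulgC.
- by rewrite card_mx mul1n card_ord Zp.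
Qed.
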